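(* Let $K$ be a field, let $I$ be a monomial ideal of $R = K[x,y,z]$, and let $J$ be the ideal of $S = K[x,y]$ generated by the generators of $I$ with $x+y$ substituted for $z$. Fix an integer $d$ and set $N = N(T_d(I))$, considered as a matrix over $K$. Then $\dim_K [S/J]_{d-1} = \dim_K \ker N^{\mathrm T}$.
   Context: $N(T_d(I))$ is the lattice path matrix of the triangular region $T_d(I)$, defined as follows (for $d\ge1$). Let $A_1,\dots,A_m$ be the monomials of degree $d-1$ in $x,y$ only (not divisible by $z$) that are not in $I$. Let $E_1,\dots,E_n$ be the monomials $u$ of degree $d-1$ in $x,y,z$ such that $z\mid u$, $u\in I$, and $u/z\notin I$. Both lists are ordered from smallest to largest in the reverse-lexicographic order ($x^ay^bz^c>x^py^qz^r$ if the last non-zero entry of $(a-p,b-q,c-r)$ is negative). Identify the monomial $x^ay^bz^{d-1-a-b}$ with the point $(d-1-b,a)\in\mathbb{Z}^2$. Then $N(T_d(I))$ is the $m\times n$ integer matrix whose $(i,j)$ entry is the number of lattice paths in $\mathbb{Z}^2$ from $A_i$ to $E_j$ with steps $(1,0)$ and $(0,-1)$. Explicitly, for $A_i=x^sy^{d-1-s}$ and $E_j=x^py^{d-1-p-e}z^e$ the entry is $\binom{e}{s-p}$ (zero if $s<p$ or $s-p>e$). (Geometrically, with $T_d(I)$ the part of a triangle of side length $d$, subdivided into upward-pointing unit triangles labelled by monomials of degree $d-1$ and downward-pointing unit triangles labelled by monomials of degree $d-2$, whose labels are not in $I$, the $A_i$ and $E_j$ correspond to the unit edges parallel to the upper-left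 side of the big triangle that belong only to an upward-pointing, respectively only to a downward-pointing, triangle of $T_d(I)$.) $N^{\mathrm T}$ denotes the transpose, so $\ker N^{\mathrm T}\subset K^m$. *)

(* Defs.v *)
From HB Require Import structures.
From mathcomp Require Import all_boot all_order all_algebra.
From mathcomp Require Import boolp classical_sets.
From mathcomp.multinomials Require Import mpoly.

Set Implicit Arguments.
Unset Strict Implicit.
Unset Printing Implicit Defensive.

Import GRing.Theory.

Local Open Scope classical_set_scope.
Local Open Scope ring_scope.

Definition ideal_gen (R : comNzRingType) (G : set R) : set R :=
  [set f | exists2 s : seq (R * R),
     (forall p, p \in s -> G p.2) & f = \sum_(p <- s) p.1 * p.2].

Section GradedQuotient.
Variables (K : fieldType) (n : nat).

(* The residue classes modulo J of b_0, ..., b_(r-1) form a K-basis of the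
   degree e component of the graded ring {mpoly K[n]} / J, for J homogeneous. *)
Definition is_graded_quot_basis (J : set {mpoly K[n]}) (e r : nat)
    (b : 'I_r -> {mpoly K[n]}) : Prop :=
  [/\ forall i, b i \is e.-homog,
      forall f : {mpoly K[n]}, f \is e.-homog ->
        exists c : 'I_r -> K, J (f - \sum_(i < r) c i *: b i)
    & forall c : 'I_r -> K, J (\sum_(i < r) c i *: b i) -> forall i, c i = 0].

Definition graded_quot_dim (J : set {mpoly K[n]}) (e r : nat) : Prop :=
  exists b : 'I_r -> {mpoly K[n]}, is_graded_quot_basis J e b.

End GradedQuotient.

(* The variables x, y, z of K[x,y,z] are 'X_0, 'X_1, 'X_2 in {mpoly K[3]}. *)
Definition ix : 'I_3 := inord 0.
Definition iy : 'I_3 := inord 1.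
Definition iz : 'I_3 := inord 2.

Definition x_y_xplusy (K : fieldType) : 3.-tuple {mpoly K[2]} :=
  [tuple 'X_(inord 0); 'X_(inord 1); 'X_(inord 0) + 'X_(inord 1)].

(* u is smaller than v: the last non-zero entry of v - u is negative. *)
Definition revlex_lt (n : nat) (u v : 'X_{1..n}) : bool :=
  [exists i : 'I_n, (v i < u i)%N && [forall j : 'I_n, (i < j)%N ==> (v j == u j)]].

Definition revlex_le (n : nat) (u v : 'X_{1..n}) : bool :=
  (u == v) || revlex_lt u v.

Definition monomials (n e : nat) : seq 'X_{1..n} :=
  [seq m : 'X_{1..n} <- [seq bmnm m | m <- enum {: 'X_{1..n < e.+1}}] | mdeg m == e].

Definition lattice_step (p : int * int) (right : bool) : int * int :=
  if right then (p.1 + 1, p.2) else (p.1, p.2 - 1).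

(* Every path from p to q with steps (1,0) and (0,-1) has exactly
   |q.1 - p.1| + |q.2 - p.2| steps, so only step words of that length count. *)
Definition lattice_paths (p q : int * int) : nat :=
  #|[set w : (absz (q.1 - p.1)%R + absz (q.2 - p.2)%R).-tuple bool
     | foldl lattice_step p w == q]%SET|.

Section LatticePathMatrix.
Variables (K : fieldType) (I : set {mpoly K[3]}) (d : nat).

Definition in_ideal (m : 'X_{1..3}) : bool := `[< I 'X_[m] >].

Definition A_monomials : seq 'X_{1..3} :=
  sort (@revlex_le 3)
    [seq m : 'X_{1..3} <- monomials 3 d.-1 | (m iz == 0%N) && ~~ in_ideal m].

Definition E_monomials : seq 'X_{1..3} :=
  sort (@revlex_le 3)
    [seq m : 'X_{1..3} <- monomials 3 d.-1
    | [&& (0 < m iz)%N, in_ideal m & ~~ in_ideal (m - U_(iz))%MM]].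

Definition lattice_point (m : 'X_{1..3}) : int * int :=
  (d%:Z - 1 - (m iy)%:Z, (m ix)%:Z).

Definition lattice_path_matrix :
    'M[int]_(size A_monomials, size E_monomials) :=
  \matrix_(i, j)
    (lattice_paths (lattice_point (tnth (in_tuple A_monomials) i))
                   (lattice_point (tnth (in_tuple E_monomials) j)))%:Z.

End LatticePathMatrix.

(* Main.v *)
(* Write phi for the substitution z := x + y, which maps I onto J. For a monomial
   u in I divisible by z with u / z in I, phi u = phi (x u / z) + phi (y u / z)
   involves elements of I with a smaller z-exponent. By induction, J in degree
   d - 1 is spanned by the monomials of I in x, y alone and the phi E_j. The
   former span the kernel of the projection of S_(d-1) onto the span of the A_i,
   and by the binomial theorem that projection maps phi E_j to column j of N.
   Hence the degree d - 1 part of S/J is K^m modulo the column space of N. *)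
Require Import Defs.
From HB Require Import structures.
From mathcomp Require Import all_boot all_order all_algebra.
From mathcomp Require Import boolp classical_sets.
From mathcomp.multinomials Require Import mpoly.
From mathcomp Require Import zify ring.

Set Implicit Arguments.
Unset Strict Implicit.
Unset Printing Implicit Defensive.

Import GRing.Theory.

Local Open Scope classical_set_scope.
Local Open Scope ring_scope.

(** * Counting lattice paths *)

Lemma foldl_lattice_step (p : int * int) (w : seq bool) :
  foldl lattice_step p w
  = (p.1 + (count id w)%:Z, p.2 - (count negb w)%:Z).
Proof.
elim: w p => [|b w IHw] p /=; first by rewrite addr0 subr0 -surjective_pairing.
by rewrite IHw; case: b => /=; congr pair; lia.
Qed.

(** Sending a word to the set of positions of its [false] letters is a bijection onto the subsets of
    ['I_n], and it turns the number of such letters into cardinality. *)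
Lemma card_bool_tuples (n k : nat) :
  #|[set w : n.-tuple bool | count negb w == k]%SET| = 'C(n, k).
Proof.
pose f (w : n.-tuple bool) : {set 'I_n} := [set i | ~~ tnth w i]%SET.
have f_inj : injective f.
  move=> u v /setP uv; apply: eq_from_tnth => i.
  by have := uv i; rewrite !inE => /negb_inj.
have f_surj (A : {set 'I_n}) : exists w, f w = A.
  exists [tuple i \notin A | i < n]; apply/setP => i.
  by rewrite inE tnth_mktuple negbK.
have card_f w : #|f w| = count negb w.
  rewrite cardE size_filter -enumT /= -[in RHS](map_tnth_enum w) count_map.
  by apply: eq_count => i; rewrite /= inE.
rewrite -(card_imset _ f_inj) -[in RHS](card_ord n) -card_draws.
apply: eq_card => A; rewrite [RHS]inE; apply/imsetP/idP => [[w]|].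
  by rewrite inE -card_f => /eqP wk ->; apply/eqP.
have [w <-] := f_surj A; rewrite card_f => wk.
by exists w; rewrite ?inE.
Qed.

(** The word length is [i + j], so a word reaches the target exactly when [j] of its letters are
    down steps. *)
Lemma lattice_paths_binomial (a b : int) (i j : nat) :
  lattice_paths (a, b) (a + i%:Z, b - j%:Z) = 'C(i + j, j).
Proof.
rewrite /lattice_paths /=.
have -> : (absz (a + i%:Z - a)%R + absz (b - j%:Z - b)%R = i + j)%N by lia.
rewrite -card_bool_tuples; apply: eq_card => w; rewrite !inE.
rewrite foldl_lattice_step xpair_eqE /=.
have := count_predC id w; rewrite size_tuple.
rewrite -[count (predC id) w]/(count negb w).
by move: (count id w) (count negb w) => u v uv; lia.
Qed.

Lemma lattice_paths_eq0 (p q : int * int) :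
  (q.1 < p.1) || (p.2 < q.2) -> lattice_paths p q = 0%N.
Proof.
move=> pq; apply: eq_card0 => w.
rewrite inE foldl_lattice_step; case: p q pq w => [a b] [a' b'] /= pq w.
by rewrite xpair_eqE; apply/negbTE; move: (count _ _) (count _ _) => i j; lia.
Qed.

(** * Exponent vectors in two and three variables *)

Lemma mdeg_X3 (m : 'X_{1..3}) : mdeg m = (m ix + m iy + m iz)%N.
Proof.
rewrite mdegE !big_ord_recl big_ord0 addn0 addnA.
by congr ((m _ + m _ + m _)%N); apply: val_inj; rewrite /= inordK.
Qed.

Lemma mdeg_X2 (m : 'X_{1..2}) : mdeg m = (m (inord 0) + m (inord 1))%N.
Proof.
rewrite mdegE !big_ord_recl big_ord0 addn0.
by congr ((m _ + m _)%N); apply: val_inj; rewrite /= inordK.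
Qed.

Lemma ord3_cases (i : 'I_3) : [\/ i = ix, i = iy | i = iz].
Proof.
case: i => [[|[|[|//]]]] lti; [constructor 1|constructor 2|constructor 3];
  by apply: val_inj; rewrite /= inordK.
Qed.

Lemma ord2_cases (i : 'I_2) : i = inord 0 \/ i = inord 1.
Proof.
by case: i => [[|[|//]]] lti; [left|right]; apply: val_inj; rewrite /= inordK.
Qed.

Definition mnm2 (a b : nat) : 'X_{1..2} := [multinom [tuple a; b]].

Definition mnm3 (a b c : nat) : 'X_{1..3} := [multinom [tuple a; b; c]].

Lemma mnm2E0 a b : mnm2 a b (inord 0) = a.
Proof. by rewrite multinomE (tnth_nth 0%N) /= inordK. Qed.

Lemma mnm2E1 a b : mnm2 a b (inord 1) = b.
Proof. by rewrite multinomE (tnth_nth 0%N) /= inordK. Qed.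

Lemma mnm3E a b c :
  (mnm3 a b c ix = a) * (mnm3 a b c iy = b) * (mnm3 a b c iz = c).
Proof. by rewrite !multinomE !(tnth_nth 0%N) /= !inordK. Qed.

Lemma mnm2_eq (u : 'X_{1..2}) a b :
  (mnm2 a b == u) = (a == u (inord 0)) && (b == u (inord 1)).
Proof.
apply/eqP/andP => [<-|[/eqP -> /eqP ->]]; first by rewrite mnm2E0 mnm2E1.
by apply/mnmP => i; case: (ord2_cases i) => ->; rewrite ?mnm2E0 ?mnm2E1.
Qed.

Definition xy_part (m : 'X_{1..3}) : 'X_{1..2} := mnm2 (m ix) (m iy).

Lemma xy_part_inj (m m' : 'X_{1..3}) :
  m iz = 0%N -> m' iz = 0%N -> xy_part m = xy_part m' -> m = m'.
Proof.
move=> mz m'z /eqP; rewrite mnm2_eq mnm2E0 mnm2E1 => /andP[/eqP mx /eqP my].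
by apply/mnmP => i; case: (ord3_cases i) => ->; rewrite ?mz ?m'z.
Qed.

Lemma mdeg_xy_part (m : 'X_{1..3}) : m iz = 0%N -> mdeg (xy_part m) = mdeg m.
Proof. by move=> mz; rewrite mdeg_X3 mz addn0 mdeg_X2 mnm2E0 mnm2E1. Qed.

(** * The substitution z := x + y on monomials *)

Section Substitution.
Variable K : fieldType.

Local Notation X := ('X_(inord 0) : {mpoly K[2]}).
Local Notation Y := ('X_(inord 1) : {mpoly K[2]}).
Local Notation phi f := (comp_mpoly (x_y_xplusy K) f).

Lemma mpolyX2 a b : X ^+ a * Y ^+ b = 'X_[mnm2 a b].
Proof.
rewrite !mpolyXn -mpolyXD; congr 'X_[_]; apply/eqP.
rewrite eq_sym mnm2_eq !mnmDE !mulmnE !mnm1E -!val_eqE /= !inordK //=.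
by rewrite !mul1n !mul0n addn0 add0n !eqxx.
Qed.

Lemma phi_mpolyX (m : 'X_{1..3}) :
  phi 'X_[m] = X ^+ m ix * Y ^+ m iy * (X + Y) ^+ m iz.
Proof.
rewrite comp_mpolyX !big_ord_recl big_ord0 mulr1 mulrA.
by congr (_ * _ * _); congr (_ ^+ _); rewrite ?(tnth_nth 0) //;
  congr (fun_of_multinom m _); apply: val_inj; rewrite /= inordK.
Qed.

Lemma phi_mpolyX_z0 (m : 'X_{1..3}) : m iz = 0%N -> phi 'X_[m] = 'X_[xy_part m].
Proof. by move=> mz; rewrite phi_mpolyX mz expr0 mulr1 mpolyX2. Qed.

Lemma mcoeff_phi_mpolyX (m : 'X_{1..3}) (u : 'X_{1..2}) :
  (phi 'X_[m])@_u =
  if (mdeg u == mdeg m) && (m ix <= u (inord 0%N))%N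
  then 'C(m iz, u (inord 0%N) - m ix)%:R else 0.
Proof.
(* The summands are swapped so that the index of the binomial expansion is the exponent of [X]. *)
rewrite phi_mpolyX [X + Y]addrC exprDn mulr_sumr raddf_sum /=.
under eq_bigr => i _.
  rewrite mulrnAr mcoeffMn [Y ^+ _ * _]mulrC mulrACA -!exprD mpolyX2 mcoeffX.
  rewrite mnm2_eq -mulrnA.
  over.
move: (u _) (u (inord 1)) (mdeg_X2 u) => a b ->; rewrite mdeg_X3.
move: (m ix) (m iy) (m iz) => p q e.
case: ifPn => [/andP[/eqP ab pa]|nab]; last first.
  apply: big1 => i _; have ie := ltn_ord i.
  by rewrite (_ : _ && _ = false) ?mul0n //; lia.
have [le|lt] := leqP (a - p) e; last first.
  rewrite bin_small //; apply: big1 => i _; have ie := ltn_ord i.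
  by rewrite (_ : _ && _ = false) ?mul0n //; lia.
(* Matching the exponent of [X] leaves only the index [a - p]. *)
rewrite (bigD1 (Ordinal (le : (a - p < e.+1)%N))) //= big1 ?addr0.
  by rewrite (_ : _ && _ = true) ?mul1n //; lia.
move=> i; rewrite -val_eqE /= => ne; have ie := ltn_ord i.
by rewrite (_ : _ && _ = false) ?mul0n //; lia.
Qed.

(** Writing a = x^s y^t and e = x^p y^q z^c, a path makes t - q right steps and s - p down steps.
    Equality of degrees makes the total c, so both sides are the binomial coefficient of c over s -
    p. *)
Lemma mcoeff_phi_lattice_paths d (a e : 'X_{1..3}) :
  (0 < d)%N -> a iz = 0%N -> mdeg a = d.-1 -> mdeg e = d.-1 ->
  (phi 'X_[e])@_(xy_part a)
  = (lattice_paths (lattice_point d a) (lattice_point d e))%:R.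
Proof.
move=> d_gt0 az dega dege; rewrite mcoeff_phi_mpolyX mnm2E0.
rewrite mdeg_xy_part // dega dege eqxx /=.
move: dega dege; rewrite !mdeg_X3 az addn0 /lattice_point.
move: (a ix) (a iy) (e ix) (e iy) (e iz) => s t p q c sd pd.
case: leqP => ps; last by rewrite lattice_paths_eq0 //=; lia.
(* If [q > t] there is no path, and the binomial coefficient vanishes as well, since equal degrees
   give [s - p > c]. *)
have [qt|tq] := leqP q t; last first.
  by rewrite lattice_paths_eq0 /= ?bin_small //; lia.
have -> : d%:Z - 1 - q%:Z = d%:Z - 1 - t%:Z + (t - q)%N%:Z by lia.
have -> : p%:Z = s%:Z - (s - p)%N%:Z by lia.
by rewrite lattice_paths_binomial; congr ('C(_, _)%:R); lia.
Qed.

End Substitution.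

(** * Lists of monomials and generated ideals *)

Lemma mem_monomials n e (m : 'X_{1..n}) : (m \in monomials n e) = (mdeg m == e).
Proof.
rewrite mem_filter; case: eqP => //= dm.
have lt_m : (mdeg m < e.+1)%N by rewrite dm.
by apply/mapP; exists (BMultinom lt_m); rewrite ?mem_enum.
Qed.

Lemma monomials_uniq n e : uniq (monomials n e).
Proof. by rewrite filter_uniq // map_inj_uniq ?enum_uniq //; apply: val_inj. Qed.

Section IdealGen.
Variable R : comNzRingType.
Implicit Types (G : set R) (f g : R).

Lemma ideal_gen0 G : ideal_gen G 0.
Proof. by exists [::]; rewrite ?big_nil. Qed.

Lemma ideal_genD G f g : ideal_gen G f -> ideal_gen G g -> ideal_gen G (f + g).
Proof.
move=> [s sG ->] [t tG ->]; exists (s ++ t); last by rewrite big_cat.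
by move=> p; rewrite mem_cat => /orP[/sG|/tG].
Qed.

Lemma ideal_genM G h f : ideal_gen G f -> ideal_gen G (h * f).
Proof.
move=> [s sG ->]; exists [seq (h * p.1, p.2) | p <- s].
  by move=> _ /mapP[p ps ->]; apply: (sG p).
by rewrite big_map mulr_sumr; apply: eq_bigr => p _; rewrite mulrA.
Qed.

Lemma ideal_gen_sum G (T : eqType) (s : seq T) (F : T -> R) :
  (forall i, i \in s -> ideal_gen G (F i)) -> ideal_gen G (\sum_(i <- s) F i).
Proof.
elim: s => [|i s IHs] sF; first by rewrite big_nil; apply: ideal_gen0.
rewrite big_cons; apply: ideal_genD; first by apply: sF; rewrite mem_head.
by apply: IHs => j js; apply: sF; rewrite inE js orbT.
Qed.

Lemma mem_ideal_gen G f : G f -> ideal_gen G f.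
Proof.
move=> Gf; exists [:: (1, f)]; last by rewrite big_seq1 mul1r.
by move=> p; rewrite inE => /eqP ->.
Qed.

End IdealGen.

Lemma rmorph_ideal_gen (R S : comNzRingType) (h : {rmorphism R -> S})
    (G : set R) (G' : set S) f :
  (forall g, G g -> G' (h g)) -> ideal_gen G f -> ideal_gen G' (h f).
Proof.
move=> GG' [s sG ->]; rewrite rmorph_sum; apply: ideal_gen_sum => p ps.
by rewrite rmorphM; apply/ideal_genM/mem_ideal_gen/GG'/sG.
Qed.

(** * Degree d - 1 of J compared with the column space of N *)

Section LatticePathMatrixQuotient.
Variables (K : fieldType) (G : set 'X_{1..3}) (d : nat).
Hypothesis d_gt0 : (0 < d)%N.

Local Notation phi f := (comp_mpoly (x_y_xplusy K) f).

Let I : set {mpoly K[3]} :=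
  ideal_gen [set ('X_[m] : {mpoly K[3]}) | m in G].
Let J : set {mpoly K[2]} :=
  ideal_gen [set ('X_[m] : {mpoly K[3]}) \mPo x_y_xplusy K | m in G].

Local Notation As := (A_monomials I d).
Local Notation Es := (E_monomials I d).
Local Notation A i := (tnth (in_tuple As) i).
Local Notation E j := (tnth (in_tuple Es) j).
(** Transposed because [<=] on matrices compares row spaces: the rows of [C] are the columns of
    N. *)
Local Notation C := (map_mx (intr : int -> K) (lattice_path_matrix I d))^T.

Lemma mem_A_monomials m :
  (m \in As) = [&& m iz == 0%N, ~~ in_ideal I m & mdeg m == d.-1].
Proof. by rewrite mem_sort mem_filter mem_monomials andbA. Qed.

Lemma mem_E_monomials m :
  (m \in Es) = [&& (0 < m iz)%N, in_ideal I m,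
                   ~~ in_ideal I (m - U_(iz))%MM & mdeg m == d.-1].
Proof. by rewrite mem_sort mem_filter mem_monomials -!andbA. Qed.

Lemma A_monomialsP i :
  [/\ A i iz = 0%N, ~ I 'X_[A i] & mdeg (A i) = d.-1].
Proof.
have := mem_tnth i (in_tuple As); rewrite mem_A_monomials.
by move=> /and3P[/eqP ? /asboolPn ? /eqP ?].
Qed.

Lemma E_monomialsP j : I 'X_[E j] /\ mdeg (E j) = d.-1.
Proof.
have := mem_tnth j (in_tuple Es); rewrite mem_E_monomials.
by move=> /and4P[_ /asboolP ? _ /eqP ?].
Qed.

Lemma xy_part_A_inj i j : (xy_part (A i) == xy_part (A j)) = (i == j).
Proof.
apply/eqP/eqP => [eq_ij|-> //]; apply/(tuple_uniqP (in_tuple As)).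
  by rewrite sort_uniq filter_uniq ?monomials_uniq.
have [iz0 _ _] := A_monomialsP i; have [jz0 _ _] := A_monomialsP j.
exact: xy_part_inj.
Qed.

(** The projection onto the span of the A_i, in coordinates; it kills every other monomial, in
    particular those of other degrees. *)
Definition A_coord (f : {mpoly K[2]}) : 'rV[K]_(size As) :=
  \row_i f@_(xy_part (A i)).

Fact A_coord_is_linear : linear A_coord.
Proof. by move=> c f g; apply/rowP => i; rewrite !mxE mcoeffD mcoeffZ. Qed.

HB.instance Definition _ :=
  GRing.isLinear.Build K {mpoly K[2]} 'rV[K]_(size As) _ A_coord
    A_coord_is_linear.

Lemma A_coord_E j : A_coord (phi 'X_[E j]) = row j C.
Proof.
apply/rowP => i; have [iz0 _ di] := A_monomialsP i.
have [_ dj] := E_monomialsP j.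
by rewrite !mxE (mcoeff_phi_lattice_paths _ d_gt0) // mulrz_nat.
Qed.

Lemma A_coord_A i : A_coord 'X_[xy_part (A i)] = delta_mx 0 i.
Proof.
by apply/rowP => k; rewrite !mxE mcoeffX xy_part_A_inj eqxx eq_sym.
Qed.

Lemma A_coord_phi_degree m : mdeg m != d.-1 -> A_coord (phi 'X_[m]) = 0.
Proof.
move=> dm; apply/rowP => i; rewrite !mxE mcoeff_phi_mpolyX.
have [iz0 _ di] := A_monomialsP i.
by rewrite mdeg_xy_part // di eq_sym (negbTE dm).
Qed.

Lemma A_coord_phi_sub m : I 'X_[m] -> (A_coord (phi 'X_[m]) <= C)%MS.
Proof.
have [e] := ubnP (m iz); elim: e => // e IHe in m * => mz Im.
have [dm|/A_coord_phi_degree ->] := eqVneq (mdeg m) d.-1; last exact: sub0mx.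
have [z0|z_gt0] := posnP (m iz).
  (* Without z, [m] is its own image up to [xy_part], and lying in [I] it differs from every
     [A i]. *)
  suff -> : A_coord (phi 'X_[m]) = 0 by apply: sub0mx.
  apply/rowP => i; rewrite !mxE phi_mpolyX_z0 // mcoeffX.
  case: eqP => // eq_mi; have [iz0 niI _] := A_monomialsP i; case: niI.
  by rewrite -(xy_part_inj z0 iz0 eq_mi).
have [inE|] := boolP (m \in Es).
  have /tnthP[j ->] : m \in in_tuple Es by [].
  by rewrite A_coord_E row_sub.
rewrite mem_E_monomials z_gt0 dm eqxx andbT /in_ideal asboolT //= negbK.
move=> /asboolP Imz; set u := (m - U_(iz))%MM in Imz.
have uE k : u k = (m k - (iz == k))%N by rewrite mnmBE mnm1E.
have neq : ((ix == iz) = false) * ((iy == iz) = false) * ((iz == ix) = false) *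
  ((iz == iy) = false) * ((ix == iy) = false) * ((iy == ix) = false).
  by rewrite -!val_eqE /= !inordK.
(* One factor z of [m] is expanded as x + y. Both new monomials are multiples of [u], hence in [I],
   with z-exponent one lower. *)
have phi_m : phi 'X_[m] = phi 'X_[U_(ix) + u] + phi 'X_[U_(iy) + u].
  rewrite !phi_mpolyX !mnmDE !uE !mnm1E !eqxx !neq /= !subn0.
  rewrite -{1}(prednK z_gt0) subn1 !add0n !add1n !exprS.
  by ring.
rewrite phi_m raddfD /= addmx_sub //; apply: IHe;
  rewrite ?mpolyXD; try exact: ideal_genM;
  by rewrite mnmDE uE mnm1E neq eqxx; move: mz z_gt0; case: (m iz) => //= k; lia.
Qed.

Lemma ideal_A_coord_sub f : J f -> (A_coord f <= C)%MS.
Proof.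
move=> [s sG ->]; rewrite raddf_sum big_seq summx_sub // => p /sG[m Gm <-].
rewrite (mpolyE p.1) mulr_suml raddf_sum summx_sub // => u _.
rewrite /= -scalerAl linearZ scalemx_sub //.
(* A monomial coefficient from K[x,y] lifts to K[x,y,z] with z-exponent 0, so its product with a
   generator of [J] is the image of a monomial of [I]. *)
have -> : 'X_[u] = phi 'X_[mnm3 (u (inord 0)) (u (inord 1)) 0].
  rewrite phi_mpolyX_z0 ?mnm3E //; congr 'X_[_]; apply/eqP.
  by rewrite eq_sym mnm2_eq !mnm3E !eqxx.
rewrite -rmorphM -mpolyXD A_coord_phi_sub // mpolyXD.
by apply/ideal_genM/mem_ideal_gen; exists m.
Qed.

Lemma ideal_phi m : I 'X_[m] -> J (phi 'X_[m]).
Proof.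
by apply: rmorph_ideal_gen => _ [u Gu <-]; exists u.
Qed.

Lemma phi_mpolyX_homog m : phi 'X_[m] \is (mdeg m).-homog.
Proof.
apply/dhomogP => u; rewrite mcoeff_msupp mcoeff_phi_mpolyX.
by case: (mdeg u =P mdeg m) => //=; rewrite eqxx.
Qed.

(** Subtracting a combination [g] of the images of the [E j] with the same coordinates as [f] leaves
    only monomials of [I] in x and y. *)
Lemma A_coord_sub_ideal f :
  f \is d.-1.-homog -> (A_coord f <= C)%MS -> J f.
Proof.
move=> f_homog /submxP[w fw].
pose g := \sum_j w 0 j *: phi 'X_[E j].
have coord_g : A_coord g = A_coord f.
  rewrite fw mulmx_sum_row raddf_sum; apply: eq_bigr => j _.
  by rewrite /= linearZ /= A_coord_E.
have g_homog : g \is d.-1.-homog.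
  apply: rpred_sum => j _; apply: rpredZ.
  by have [_ <-] := E_monomialsP j; apply: phi_mpolyX_homog.
have Jg : J g.
  apply: ideal_gen_sum => j _; rewrite -mul_mpolyC.
  by apply/ideal_genM/ideal_phi; have [] := E_monomialsP j.
rewrite -[f](subrK g); apply: ideal_genD => //.
rewrite [f - g]mpolyE; apply: ideal_gen_sum => u u_supp.
rewrite -mul_mpolyC; apply: ideal_genM.
have du : mdeg u = d.-1.
  exact: (dhomog_mf (rpredB f_homog g_homog) u_supp).
pose m := mnm3 (u (inord 0)) (u (inord 1)) 0.
have um : u = xy_part m by apply/eqP; rewrite eq_sym mnm2_eq !mnm3E !eqxx.
have mz : m iz = 0%N by rewrite mnm3E.
rewrite um -phi_mpolyX_z0 //; apply: ideal_phi.
have dm : mdeg m = d.-1 by rewrite mdeg_X3 !mnm3E addn0 -mdeg_X2.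
have [//|nIm] := pselect (I 'X_[m]).
(* Otherwise [m] is some [A i], at which [f - g] has coefficient 0, although [u] is in its
   support. *)
have /tnthP[i mi] : m \in in_tuple As.
  by rewrite mem_A_monomials mz dm !eqxx andbT; apply/asboolPn.
have /rowP/(_ i) : A_coord (f - g) = 0 by rewrite raddfB /= coord_g subrr.
by rewrite !mxE -mi -um => /eqP; rewrite mcoeff_eq0 u_supp.
Qed.

(** By the two preceding inclusions, membership in [J] in degree d - 1 means having coordinates in
    the row space of [C]. A basis of a complement therefore gives a basis of the quotient: the sum
    being full yields generation, the zero intersection independence. *)
Lemma is_graded_quot_basis_compl r (B : 'M[K]_(r, size As)) :
  row_free B -> (B :=: C^C)%MS ->
  is_graded_quot_basis J d.-1
    (fun i => \sum_j B i j *: 'X_[xy_part (A j)]).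
Proof.
move=> B_free BC.
set b := fun i : 'I_r => _.
have b_homog i : b i \is d.-1.-homog.
  apply: rpred_sum => j _; apply: rpredZ; have [jz0 _ <-] := A_monomialsP j.
  by rewrite -phi_mpolyX_z0 //; apply: phi_mpolyX_homog.
have coord_b (c : 'I_r -> K) :
    A_coord (\sum_i c i *: b i) = (\row_i c i) *m B.
  rewrite mulmx_sum_row raddf_sum; apply: eq_bigr => i _.
  rewrite /= linearZ /= mxE raddf_sum [row i B]row_sum_delta; congr (_ *: _).
  by apply: eq_bigr => j _; rewrite /= linearZ /= A_coord_A mxE.
split=> // [f f_homog|c Jc].
  have : (A_coord f <= C + C^C)%MS by rewrite submx_full ?addsmx_compl_full.
  case/sub_addsmxP => [[u v]] /= fuv.
  have /submxP[c vc] : (v *m C^C <= B)%MS by rewrite BC submxMl.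
  exists (c 0); apply: A_coord_sub_ideal.
    by apply: rpredB => //; apply: rpred_sum => i _; apply/rpredZ/b_homog.
  rewrite raddfB /= coord_b fuv vc.
  rewrite (_ : \row_i c 0 i = c) ?addrK ?submxMl //.
  by apply/rowP => i; rewrite mxE.
have := ideal_A_coord_sub Jc; rewrite coord_b => cC.
have : ((\row_i c i) *m B <= C :&: C^C)%MS by rewrite sub_capmx cC -BC submxMl.
rewrite capmx_compl submx0 -[X in _ == X](mul0mx _ B) => /eqP.
by move=> /(row_free_inj B_free)/rowP c0 i; have := c0 i; rewrite !mxE.
Qed.

End LatticePathMatrixQuotient.

(** * Kernel dimension as the rank of a complement *)

Lemma dim_lker_mulmx (K : fieldType) m n (M : 'M[K]_(m, n)) :
  \dim (lker (linfun (mulmx M : 'cV[K]_n -> 'cV[K]_m))) = \rank (M^C)%MS.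
Proof.
pose B := row_base (kermx M^T).
(* [H] parametrizes the kernel of [M] by coordinates in the basis [B]. It is injective because [B]
   is row free, so the dimension is n minus the rank of [M], which is also the rank of the
   complement. *)
pose H := linfun (trmx \o mulmxr B :
  'rV[K]_(\rank (kermx M^T)) -> 'cV[K]_n).
have HE u : H u = (u *m B)^T by rewrite lfunE.
have imH : limg H = lker (linfun (mulmx M : 'cV[K]_n -> 'cV[K]_m)).
  apply/vspaceP => v; rewrite memv_ker lfunE /=; apply/memv_imgP/eqP.
    case=> u _ ->; rewrite HE; apply: trmx_inj.
    rewrite trmx0 trmx_mul trmxK; apply/sub_kermxP.
    by rewrite (submx_trans (submxMl _ _)) // eq_row_base.
  move=> Mv0; have /submxP[u vu] : (v^T <= B)%MS.
    by rewrite eq_row_base; apply/sub_kermxP; rewrite -trmx_mul Mv0 trmx0.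
  by exists u; rewrite ?memvf // HE -vu trmxK.
rewrite -imH limg_dim_eq; last first.
  apply/eqP; rewrite capfv; apply/lker0P => u v; rewrite !HE.
  by move=> /trmx_inj/(row_free_inj (row_base_free _)).
by rewrite dimvf dim_matrix mul1r mxrank_ker mxrank_tr mxrank_compl.
Qed.

Theorem proposition8p15 (K : fieldType) (I : set {mpoly K[3]})
    (G : set 'X_{1..3})
    (hI : I = ideal_gen [set ('X_[m] : {mpoly K[3]}) | m in G])
    (d : nat) (hd : (1 <= d)%N) :
  let J : set {mpoly K[2]} :=
    ideal_gen [set ('X_[m] : {mpoly K[3]}) \mPo x_y_xplusy K | m in G] in
  let N := map_mx (intr : int -> K) (lattice_path_matrix I d) in
  graded_quot_dim J (d - 1)
    (\dim (lker (linfun (mulmx N^T : 'cV[K]_(size (A_monomials I d)) ->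
                                     'cV[K]_(size (E_monomials I d)))))).
Proof.
subst I => J N; rewrite dim_lker_mulmx subn1.
(* The basis comes from a row basis of a complement of the column space of N, whose rank is the
   dimension of the kernel of [N^T]. *)
exists (fun i => \sum_j row_base (N^T)^C%MS i j *:
  'X_[xy_part (tnth (in_tuple (A_monomials _ d)) j)]).
apply: is_graded_quot_basis_compl => //; first exact: row_base_free.
exact: eq_row_base.
Qed.
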